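(* Let $\nu>0$ and let $\Theta=\{\mathbf{x}_1,\dots,\mathbf{x}_{n+1}\}\subset\mathbb{R}^n$ be a fixed set of $n+1$ affinely independent vectors. Let $\mathbf{x}_0\in\mathbb{R}^n$ be a point such that $\ell_1(\mathbf{x}_0)>0$ and $\ell_i(\mathbf{x}_0)\le0$ for all $i\in\{2,\dots,n+1\}$. Define $$\mathbf{w}=\frac{\sum_{i=0}^{n+1}|\ell_i(\mathbf{x}_0)|\,\mathbf{x}_i}{\sum_{i=0}^{n+1}|\ell_i(\mathbf{x}_0)|},\qquad \bar z(\Theta,\mathbf{x}_0)=\frac{\nu}{2}\sum_{i=0}^{n+1}|\ell_i(\mathbf{x}_0)|\,\|\mathbf{x}_i-\mathbf{w}\|^2 .$$ Then $\mathbf{w}=\mathbf{x}_1$ and $\bar z(\Theta,\mathbf{x}_0)=z(\Theta,\mathbf{x}_0)$, where $z(\Theta,\mathbf{x}_0)$ is the sharp error bound, i.e. the maximum of $|\hat f(\mathbf{x}_0)-f(\mathbf{x}_0)|$ over all $f\in C^{1,1}_\nu(\mathbb{R}^n)$.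
   Context: $\|\cdot\|$ is the Euclidean norm. $C^{1,1}_\nu(\mathbb{R}^n)$ is the class of continuously differentiable functions $f:\mathbb{R}^n\to\mathbb{R}$ whose derivative satisfies $\|Df(\mathbf{u})-Df(\mathbf{v})\|\le\nu\|\mathbf{u}-\mathbf{v}\|$ for all $\mathbf{u},\mathbf{v}\in\mathbb{R}^n$. For each $f$, $\hat f$ is the unique affine function with $\hat f(\mathbf{x}_i)=f(\mathbf{x}_i)$ for $i=1,\dots,n+1$. For $i=1,\dots,n+1$, $\ell_i$ is the Lagrange polynomial of $\Theta$, i.e. the unique affine function with $\ell_i(\mathbf{x}_j)=1$ if $j=i$ and $\ell_i(\mathbf{x}_j)=0$ if $j\ne i$ ($j=1,\dots,n+1$); additionally $\ell_0$ is the constant function $\ell_0\equiv-1$. *)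

(* Defs.v *)
From HB Require Import structures.
From mathcomp Require Import all_boot all_order all_algebra.
From mathcomp Require Import all_classical all_reals all_analysis.

Set Implicit Arguments.
Unset Strict Implicit.
Unset Printing Implicit Defensive.

Import Order.TTheory GRing.Theory Num.Theory.
Import numFieldNormedType.Exports.

Local Open Scope classical_set_scope.
Local Open Scope ring_scope.

Section Definitions.
Context {R : realType} {n : nat}.
Implicit Types (u v : 'rV[R]_n) (f g : 'rV[R]_n -> R).

(* The norm `|u| that the library puts on 'rV[R]_n is the sup norm, so the
   Euclidean norm is defined here.  The two norms induce the same topology, so
   [differentiable] and [continuous] have their usual meaning on R^n. *)
Definition enorm u : R := Num.sqrt (\sum_(i < n) u 0 i ^+ 2).

Definition gradient f u : 'rV[R]_n := \row_(i < n) 'D_(delta_mx 0 i) f u.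

(* The Euclidean norm of a linear form is that of its coordinate vector, so
   Df(u) is represented by the gradient of f at u. *)
Definition C11 (nu : R) : set ('rV[R]_n -> R) :=
  [set f | [/\ forall u, differentiable f u,
               continuous (gradient f) &
               forall u v, enorm (gradient f u - gradient f v)
                             <= nu * enorm (u - v)]].

Definition is_affine g : Prop :=
  exists (a : 'rV[R]_n) (b : R), forall u,
    g u = (\sum_(i < n) a 0 i * u 0 i) + b.

(* The sample points x_1, ..., x_{n+1} are x ord0, ..., x ord_max. *)
Definition affinely_independent (x : 'I_n.+1 -> 'rV[R]_n) : Prop :=
  forall c : 'I_n.+1 -> R,
    \sum_i c i = 0 -> \sum_i c i *: x i = 0 -> forall i, c i = 0.

(* [get] selects an element of the set; if x is affinely independent, the set
   is a singleton. *)
Definition affine_interp (x : 'I_n.+1 -> 'rV[R]_n) (y : 'I_n.+1 -> R) :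
    'rV[R]_n -> R :=
  get [set g | is_affine g /\ forall i, g (x i) = y i].

Definition interpolant (x : 'I_n.+1 -> 'rV[R]_n) f : 'rV[R]_n -> R :=
  affine_interp x (f \o x).

Definition lagrange_poly (x : 'I_n.+1 -> 'rV[R]_n) (i : 'I_n.+1) :
    'rV[R]_n -> R :=
  affine_interp x (fun j => (j == i)%:R).

(* The families indexed by 0, ..., n+1: index ord0 stands for x_0, resp. for
   the constant function -1, and index [lift ord0 j] for x j, resp. for
   [lagrange_poly x j]. *)
Definition point0 (x : 'I_n.+1 -> 'rV[R]_n) (x0 : 'rV[R]_n) (i : 'I_n.+2) :
    'rV[R]_n :=
  if unlift ord0 i is Some j then x j else x0.

Definition lagrange_poly0 (x : 'I_n.+1 -> 'rV[R]_n) (i : 'I_n.+2) :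
    'rV[R]_n -> R :=
  if unlift ord0 i is Some j then lagrange_poly x j else fun=> -1.

Definition w_center (x : 'I_n.+1 -> 'rV[R]_n) (x0 : 'rV[R]_n) : 'rV[R]_n :=
  (\sum_(i < n.+2) `|lagrange_poly0 x i x0|)^-1 *:
    \sum_(i < n.+2) `|lagrange_poly0 x i x0| *: point0 x x0 i.

Definition zbar (nu : R) (x : 'I_n.+1 -> 'rV[R]_n) (x0 : 'rV[R]_n) : R :=
  nu / 2 * \sum_(i < n.+2) `|lagrange_poly0 x i x0| *
                           enorm (point0 x x0 i - w_center x x0) ^+ 2.

Definition interp_errors (nu : R) (x : 'I_n.+1 -> 'rV[R]_n) (x0 : 'rV[R]_n) :
    set R :=
  [set `|interpolant x f x0 - f x0| | f in C11 nu].

Definition is_maximum (A : set R) (m : R) : Prop := A m /\ ubound A m.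

Definition is_sharp_error_bound (nu : R) (x : 'I_n.+1 -> 'rV[R]_n)
    (x0 : 'rV[R]_n) (z : R) : Prop :=
  is_maximum (interp_errors nu x x0) z.

End Definitions.

(* Main.v *)
Require Import Defs.
From mathcomp Require Import all_boot all_order all_algebra.
From mathcomp Require Import all_classical all_reals all_analysis.
From mathcomp Require Import ring lra.

Import Order.TTheory GRing.Theory Num.Theory.
Import numFieldNormedType.Exports.
Local Open Scope classical_set_scope.
Local Open Scope ring_scope.

(** Write [x_1] for [x ord0] and [l i] for [lagrange_poly x i x0].  These numbers are the barycentric
    coordinates of [x0] with respect to the [x i]: they sum to 1, and the [x i]
    weighted by them sum to [x0].  With the extra weight -1 on [x0] all the
    weights sum to 0, and so does the weighted sum of the points.

    Since only [l ord0] is positive, [|l i| = 2 l ord0 [i = ord0] - l i].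
    Summing this identity against 1 and against the points gives [2 l ord0] and
    [2 l ord0 x_1], whence [w = x_1] ([w_center_eq]).

    The interpolation error of [f] at [x0] is the weighted sum of the values of
    [f] ([interpolantE]).  The weights annihilate affine functions, so [f] may
    be replaced by its first-order Taylor remainder at any point, in particular
    at [w = x_1]; that remainder is at most [nu/2 |u - x_1|^2] at [u]
    ([C11_taylor_le]), and the triangle inequality yields the bound
    [zbar].  It is attained by the quadratic [nu/2 |u - x_1|^2] itself
    ([scaled_sqdist_C11]): the only positive weight sits at [x_1], where this
    function vanishes, so all the terms of the error have the same sign and
    the triangle inequality is an equality. *)

(** * Barycentric coordinates and affine interpolation *)

Section Barycentric.
Context {R : realType} {n : nat}.
Implicit Types (x : 'I_n.+1 -> 'rV[R]_n) (c y : 'I_n.+1 -> R) (u : 'rV[R]_n).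

(** Homogeneous coordinates [(1, x i)] as rows: they turn affine combinations
    into linear ones, and affine independence into invertibility. *)
Definition homogeneous_mx x : 'M[R]_(n.+1, 1 + n) :=
  row_mx (const_mx 1) (\matrix_i x i).

Lemma mul_homogeneous_mx x (v : 'rV[R]_n.+1) :
  v *m homogeneous_mx x =
  row_mx (\sum_i v 0 i)%:M (\sum_i v 0 i *: x i).
Proof.
rewrite /homogeneous_mx mul_mx_row; congr row_mx.
  by apply/rowP => j; rewrite !mxE (ord1 j) mulr1n; apply: eq_bigr => i _;
     rewrite mxE mulr1.
by rewrite mulmx_sum_row; apply: eq_bigr => i _; rewrite rowK.
Qed.

Lemma homogeneous_mx_unit x :
  affinely_independent x -> (homogeneous_mx x : 'M[R]_n.+1) \in unitmx.
Proof.
move=> hx; rewrite -row_free_unit; apply: inj_row_free => v.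
rewrite mul_homogeneous_mx -(@row_mx0 _ 1 1 n) => E.
have [] := @eq_row_mx _ 1 1 n _ _ _ _ E.
move=> /matrixP/(_ 0 0); rewrite !mxE mulr1n => s0 sx0.
by apply/rowP => i; rewrite row_mx0 mxE; exact: (hx (fun i => v 0 i) s0 sx0).
Qed.

Lemma barycentric_exists x u : affinely_independent x ->
  exists c, \sum_i c i = 1 /\ \sum_i c i *: x i = u.
Proof.
move=> /homogeneous_mx_unit hu.
pose v := (row_mx 1%:M u : 'rV[R]_(1 + n)) *m invmx (homogeneous_mx x : 'M[R]_n.+1).
have := mul_homogeneous_mx x v; rewrite /v mulmxKV // => E.
have [] := @eq_row_mx _ 1 1 n _ _ _ _ E.
move=> /matrixP/(_ 0 0); rewrite !mxE !mulr1n => s1 su.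
by exists (fun i => v 0 i).
Qed.

Lemma affine_interp_exists x y : affinely_independent x ->
  exists g : 'rV[R]_n -> R, is_affine g /\ forall i, g (x i) = y i.
Proof.
move=> /homogeneous_mx_unit hu.
have [a aE] : exists a : 'cV[R]_(1 + n),
    (homogeneous_mx x : 'M[R]_n.+1) *m a = \col_i y i.
  by exists (invmx (homogeneous_mx x : 'M[R]_n.+1) *m \col_i y i); rewrite mulKVmx.
exists (fun u => (\sum_(j < n) a (rshift 1 j) 0 * u 0 j) + a (lshift n 0) 0).
split; first by exists (\row_j a (rshift 1 j) 0), (a (lshift n 0) 0) => u;
  congr (_ + _); apply: eq_bigr => j _; rewrite mxE.
move=> i; move: aE => /matrixP/(_ i 0); rewrite !mxE => <-.
rewrite (@big_split_ord _ _ _ 1 n) big_ord1 /= addrC /homogeneous_mx.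
congr (_ + _); last by rewrite (@row_mxEl _ _ 1 n) mxE mul1r.
by apply: eq_bigr => j _; rewrite (@row_mxEr _ _ 1 n) mxE mulrC.
Qed.

Lemma affine_combination (g : 'rV[R]_n -> R) x c :
  is_affine g -> \sum_i c i = 1 ->
  g (\sum_i c i *: x i) = \sum_i c i * g (x i).
Proof.
move=> [a [b ga]] c1; rewrite ga.
under [RHS]eq_bigr do rewrite ga mulrDr mulr_sumr.
rewrite big_split /= -mulr_suml c1 mul1r exchange_big /=; congr (_ + _).
apply: eq_bigr => j _; rewrite summxE mulr_sumr; apply: eq_bigr => i _.
by rewrite mxE mulrCA.
Qed.

Lemma affine_interp_barycentric x y c u : affinely_independent x ->
  \sum_i c i = 1 -> \sum_i c i *: x i = u ->
  affine_interp x y u = \sum_i c i * y i.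
Proof.
move=> hx c1 <-; rewrite /affine_interp; case: (getPex (affine_interp_exists x y hx)).
by move=> aff itp; rewrite affine_combination //; apply: eq_bigr => i _; rewrite itp.
Qed.

Lemma lagrange_polyE x c u i : affinely_independent x ->
  \sum_i c i = 1 -> \sum_i c i *: x i = u -> lagrange_poly x i u = c i.
Proof.
move=> hx c1 cu; rewrite /lagrange_poly (affine_interp_barycentric _ _ c) //.
rewrite (bigD1 i) //= eqxx mulr1 big1 ?addr0 // => j /negPf ->.
by rewrite mulr0.
Qed.

Lemma sum_lagrange_poly x u : affinely_independent x ->
  \sum_i lagrange_poly x i u = 1.
Proof.
move=> hx; have [c [c1 cu]] := barycentric_exists x u hx.
by rewrite -[RHS]c1; apply: eq_bigr => i _; exact: lagrange_polyE.
Qed.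

Lemma sum_lagrange_polyZ x u : affinely_independent x ->
  \sum_i lagrange_poly x i u *: x i = u.
Proof.
move=> hx; have [c [c1 cu]] := barycentric_exists x u hx.
by rewrite -[RHS]cu; apply: eq_bigr => i _; rewrite (lagrange_polyE _ c).
Qed.

Lemma interpolantE x (f : 'rV[R]_n -> R) u : affinely_independent x ->
  interpolant x f u = \sum_i lagrange_poly x i u * f (x i).
Proof.
move=> hx; apply: affine_interp_barycentric => //.
  exact: sum_lagrange_poly.
exact: sum_lagrange_polyZ.
Qed.

End Barycentric.

(** * Functions with Lipschitz gradient *)

Section Smooth.
Context {R : realType} {n : nat}.
Implicit Types (u v d p : 'rV[R]_n) (f : 'rV[R]_n -> R) (nu : R).

Lemma enorm_ge0 u : 0 <= enorm u. Proof. exact: sqrtr_ge0. Qed.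

Lemma enorm_sqr u : enorm u ^+ 2 = \sum_(i < n) u 0 i ^+ 2.
Proof. by rewrite sqr_sqrtr // sumr_ge0 // => i _; rewrite sqr_ge0. Qed.

Lemma enormZ (a : R) u : enorm (a *: u) = `|a| * enorm u.
Proof.
rewrite /enorm; under eq_bigr do rewrite mxE exprMn.
by rewrite -mulr_sumr sqrtrM ?sqr_ge0 // sqrtr_sqr.
Qed.

(** Cauchy-Schwarz in the only form in which it is applied; with a bound
    [s * enorm d] at hand, summing the inequalities
    [2 s |g_i d_i| <= g_i ^ 2 + s ^ 2 d_i ^ 2] suffices. *)
Lemma dot_le (g d : 'rV[R]_n) (s : R) : 0 < s ->
  enorm g <= s * enorm d ->
  `|\sum_(i < n) d 0 i * g 0 i| <= s * enorm d ^+ 2.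
Proof.
move=> s0 gd.
have gd2 : enorm g ^+ 2 <= s ^+ 2 * enorm d ^+ 2.
  by rewrite -exprMn ler_sqr // nnegrE ?enorm_ge0 // mulr_ge0 ?enorm_ge0 // ltW.
rewrite -(@ler_pM2l _ (2 * s)) ?mulr_gt0 //.
apply: (@le_trans _ _ (enorm g ^+ 2 + s ^+ 2 * enorm d ^+ 2)); last by lra.
apply: (@le_trans _ _ (2 * s * \sum_(i < n) `|d 0 i * g 0 i|)).
  by rewrite ler_pM2l ?mulr_gt0 // ler_norm_sum.
rewrite !enorm_sqr !mulr_sumr -big_split /=; apply: ler_sum => i _.
rewrite normrM -[g 0 i ^+ 2]real_normK ?num_real //.
rewrite -[d 0 i ^+ 2]real_normK ?num_real //.
have := sqr_ge0 (`|g 0 i| - s * `|d 0 i|); lra.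
Qed.

Lemma derive_gradient f u d : differentiable f u ->
  'D_d f u = \sum_(i < n) d 0 i * gradient f u 0 i.
Proof.
move=> df; rewrite deriveE // {1}(row_sum_delta d) linear_sum /=.
by apply: eq_bigr => i _; rewrite linearZ /= mxE deriveE.
Qed.

Lemma is_derive_line f u d (t : R) : differentiable f (u + t *: d) ->
  is_derive t 1 (fun s => f (u + s *: d)) ('D_d f (u + t *: d)).
Proof.
move=> df; have fd : derivable f (u + t *: d) d by exact: diff_derivable.
have E : (fun h : R => h^-1 *: (f (u + (h *: 1 + t) *: d) - f (u + t *: d))) =
         (fun h : R => h^-1 *: (f (h *: d + (u + t *: d)) - f (u + t *: d))).
  apply/funext => h; congr (_ *: (f _ - _)).
  by rewrite [h *: 1]mulr1 scalerDl addrCA.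
apply: DeriveDef; first by rewrite /derivable E.
by rewrite /derive E.
Qed.

(** The quadratic remainder bound in one variable: the mean value theorem
    applied to [p t - t * dp 0 - K / 2 * t ^ 2], whose derivative is nonpositive
    for positive [t]. *)
Lemma taylor1_le (p dp : R -> R) (K : R) :
  (forall t : R, is_derive t 1 p (dp t)) ->
  (forall t, 0 < t -> dp t - dp 0 <= t * K) ->
  p 1 - p 0 - dp 0 <= K / 2.
Proof.
move=> pd dpK.
pose q : R -> R := p - (dp 0 *: id) - ((K / 2) *: (id ^+ 2)).
have qd (t : R) : is_derive t 1 q (dp t - dp 0 - t * K).
  apply: is_derive_eq; rewrite /= expr1 !scaler1 /GRing.scale /= /idfun; lra.
have qc : {within `[0, 1], continuous q}.
  apply: continuous_subspaceT => t; apply/differentiable_continuous.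
  exact/derivable1_diffP.
have [c /[!in_itv] /andP[c0 _] E] := MVT ltr01 (fun t _ => qd t) qc.
have := dpK c c0.
have qE t : q t = p t - dp 0 * t - K / 2 * t ^+ 2 by [].
move: E; rewrite !qE; lra.
Qed.

(** Between [u] and [u + t *: (v - u)] the derivative of [f] in direction [v - u]
    changes by at most [t * nu * enorm (v - u) ^ 2]; the one-variable bound for
    [f] and for [- f] on this segment gives both signs. *)
Lemma C11_taylor_le nu f u v : 0 < nu -> C11 nu f ->
  `|f v - f u - \sum_(i < n) (v - u) 0 i * gradient f u 0 i|
    <= nu / 2 * enorm (v - u) ^+ 2.
Proof.
move=> nu0 [df _ lip]; set d := v - u.
have pd (t : R) := is_derive_line f u d t (df (u + t *: d)).
have inc (t : R) : 0 < t ->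
    `|'D_d f (u + t *: d) - 'D_d f (u + 0 *: d)| <= t * (nu * enorm d ^+ 2).
  move=> t0; rewrite scale0r addr0 !derive_gradient // -sumrB.
  have H := dot_le (gradient f (u + t *: d) - gradient f u) d (nu * t).
  rewrite mulrA [t * nu]mulrC; apply: le_trans (H _ _); last 2 first.
  - by rewrite mulr_gt0.
  - apply: le_trans (lip _ _) _.
    by rewrite addrAC subrr add0r enormZ gtr0_norm // mulrA.
  rewrite le_eqVlt; apply/orP; left; apply/eqP; congr (`|_|).
  by apply: eq_bigr => i _; rewrite -mulrBr !mxE.
have up := taylor1_le _ _ (nu * enorm d ^+ 2) pd
  (fun t t0 => le_trans (ler_norm _) (inc t t0)).
have incN (t : R) (t0 : 0 < t) : - 'D_d f (u + t *: d) -
    - 'D_d f (u + 0 *: d) <= t * (nu * enorm d ^+ 2).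
  by apply: le_trans (inc t t0); rewrite -opprD -normrN ler_norm.
have := taylor1_le _ _ (nu * enorm d ^+ 2) (fun t => is_deriveN (pd t)) incN.
move: up; rewrite !opprfctE !scale1r !scale0r !addr0 derive_gradient //.
rewrite [u + _]addrC subrK => up lo.
by rewrite ler_norml; apply/andP; split; lra.
Qed.

(** The extremal function: its gradient is [nu *: (u - p)], for which the
    Lipschitz condition holds with equality. *)
Lemma scaled_sqdist_C11 nu p : 0 <= nu ->
  C11 nu (fun u => nu / 2 * enorm (u - p) ^+ 2).
Proof.
move=> nu0.
pose h (i : 'I_n) : 'rV[R]_n -> R := (fun u => u 0 i) - cst (p 0 i).
(* Written in the ring of functions, where the differentiation rules apply. *)
have qE : (fun u => nu / 2 * enorm (u - p) ^+ 2) =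
          (nu / 2) *: \sum_(i < n) h i ^+ 2.
  apply/funext => u; rewrite enorm_sqr; congr (_ * _).
  by rewrite fct_sumE; apply: eq_bigr => i _; rewrite !mxE.
have qd u : differentiable ((nu / 2) *: \sum_(i < n) h i ^+ 2) u.
  apply: differentiableZ; apply: differentiable_sum => i.
  apply: differentiableX; apply: differentiableB => //.
  exact: differentiable_coord.
have coordd u v (i : 'I_n) : is_derive u v (fun w : 'rV[R]_n => w 0 i) (v 0 i).
  apply: DeriveDef; first exact/diff_derivable/differentiable_coord.
  (* The coordinates of the derivative of the identity, which is [v]. *)
  have := derive_id u v; rewrite derive_mx; last exact: derivable_id.
  by move=> /matrixP/(_ 0 i); rewrite mxE.
have gradE : gradient ((nu / 2) *: \sum_(i < n) h i ^+ 2) =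
             (fun u => nu *: (u - p)).
  apply/funext => u; apply/rowP => j; rewrite !mxE.
  have D := is_deriveZ (nu / 2) (is_derive_sum (fun i => is_deriveX 2
     (is_deriveB (coordd u (delta_mx 0 j) i) (is_derive_cst (p 0 i) u (delta_mx 0 j))))).
  rewrite derive_val (bigD1 j) //= big1 => [|i ij].
    rewrite !mxE !eqxx /GRing.scale /= /h /= expr1 /cst subr0 mulr1 addr0.
    rewrite -[((fun _ => _) - _) u]/(u 0 j - p 0 j); lra.
  by rewrite !mxE (negPf ij) andbF subr0 scaler0.
rewrite qE; split => //.
  rewrite gradE => u; apply: differentiable_continuous.
  by apply: differentiableZ; apply: differentiableB.
move=> u v; rewrite gradE -scalerBr enormZ ger0_norm //.
by rewrite opprB addrA subrK.
Qed.

End Smooth.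

(** * The sharp error bound *)

Section SharpBound.
Context {R : realType} {n : nat}.
Context (x : 'I_n.+1 -> 'rV[R]_n) (x0 : 'rV[R]_n).
Context (hx : affinely_independent x).
Context (h1 : 0 < lagrange_poly x ord0 x0).
Context (hi : forall i : 'I_n.+1, i != ord0 -> lagrange_poly x i x0 <= 0).

Local Notation l i := (lagrange_poly x i x0).

Lemma norm_lagrange_poly i :
  `|l i| = (i == ord0)%:R * (2 * l ord0) - l i.
Proof.
have [->|i0] := eqVneq; first by rewrite gtr0_norm // mul1r; lra.
by rewrite ler0_norm ?hi // mul0r sub0r.
Qed.

Lemma sum_norm_lagrange_polyZ (V : lmodType R) (y : 'I_n.+1 -> V) :
  \sum_i `|l i| *: y i = (2 * l ord0) *: y ord0 - \sum_i l i *: y i.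
Proof.
under eq_bigr do rewrite norm_lagrange_poly scalerBl.
rewrite sumrB; congr (_ - _).
rewrite (bigD1 ord0) //= big1 ?addr0 ?mul1r // => i /negPf ->.
by rewrite mul0r scale0r.
Qed.

(** The sums over [n + 2] indices are stated for a generic [F] because they
    serve for the denominator ([F] constant) and the numerator of the centre,
    and for the squared distances of the bound. *)
Lemma sum_lagrange_poly0Z (V : lmodType R) (F : 'rV[R]_n -> V) :
  \sum_(i < n.+2) `|lagrange_poly0 x i x0| *: F (point0 x x0 i) =
  F x0 + \sum_i `|l i| *: F (x i).
Proof.
rewrite big_ord_recl /lagrange_poly0 /point0 unlift_none normrN1 scale1r.
by congr (_ + _); apply: eq_bigr => i _; rewrite liftK.
Qed.

Lemma w_center_eq : w_center x x0 = x ord0.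
Proof.
rewrite /w_center (sum_lagrange_poly0Z _ id) sum_norm_lagrange_polyZ.
rewrite sum_lagrange_polyZ //.
have -> : \sum_(i < n.+2) `|lagrange_poly0 x i x0| = 2 * l ord0.
  have := sum_lagrange_poly0Z R^o (fun=> 1).
  rewrite sum_norm_lagrange_polyZ.
  under eq_bigr do rewrite [_ *: _]mulr1.
  move=> ->; under eq_bigr do rewrite [_ *: _]mulr1.
  by rewrite sum_lagrange_poly // [_ *: _]mulr1 addrC subrK.
by rewrite addrC subrK scalerA mulVf ?scale1r // mulf_neq0 // lt0r_neq0.
Qed.

Lemma zbarE nu : zbar nu x x0 =
  nu / 2 * (enorm (x0 - x ord0) ^+ 2 +
            \sum_i `|l i| * enorm (x i - x ord0) ^+ 2).
Proof.
rewrite /zbar w_center_eq; congr (_ * _).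
exact: (sum_lagrange_poly0Z R^o (fun u => enorm (u - x ord0) ^+ 2)).
Qed.

(** The weights annihilate affine functions, so subtracting one from [f] leaves
    the error unchanged; with [g] the gradient of [f] at [p], what remains of [f]
    is its Taylor remainder. *)
Lemma interpolation_error_taylor (f : 'rV[R]_n -> R) (g p : 'rV[R]_n)
    (r := fun u => f u - f p - \sum_(j < n) (u - p) 0 j * g 0 j) :
  interpolant x f x0 - f x0 = \sum_i l i * r (x i) - r x0.
Proof.
pose A u := f p + \sum_(j < n) (u - p) 0 j * g 0 j.
have rE u : r u = f u - A u by rewrite /r /A opprD addrA.
have affA : is_affine A.
  exists g, (f p - \sum_(j < n) p 0 j * g 0 j) => u; rewrite /A.
  under eq_bigr do rewrite !mxE mulrBl mulrC.
  by rewrite sumrB addrCA.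
have := affine_combination _ x (fun i => l i) affA (sum_lagrange_poly x x0 hx).
rewrite sum_lagrange_polyZ // interpolantE // rE.
have -> : \sum_i l i * r (x i) = \sum_i (l i * f (x i) - l i * A (x i)).
  by apply: eq_bigr => i _; rewrite rE mulrBr.
by rewrite sumrB => <-; lra.
Qed.

Lemma interpolation_error_le nu f : 0 < nu -> C11 nu f ->
  `|interpolant x f x0 - f x0| <= zbar nu x x0.
Proof.
move=> nu0 fC; rewrite (interpolation_error_taylor f (gradient f (x ord0)) (x ord0)).
have rem u := C11_taylor_le nu f (x ord0) u nu0 fC.
rewrite zbarE mulrDr [leRHS]addrC; apply: le_trans (ler_normB _ _) _.
apply: lerD => //; rewrite mulr_sumr; apply: le_trans (ler_norm_sum _ _ _) _.
by apply: ler_sum => i _; rewrite normrM mulrCA ler_wpM2l.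
Qed.

(** Every weight other than that of [x ord0] is nonpositive, and the quadratic
    vanishes at [x ord0]: no term of the error is positive, so nothing cancels
    and the error equals minus the bound. *)
Lemma interpolation_error_sqdist nu (f := fun u => nu / 2 * enorm (u - x ord0) ^+ 2) :
  0 <= nu -> `|interpolant x f x0 - f x0| = zbar nu x x0.
Proof.
move=> nu0; rewrite interpolantE // zbarE.
have f0 : f (x ord0) = 0.
  by rewrite /f subrr -[0](scale0r (0 : 'rV[R]_n)) enormZ normr0 mul0r expr0n mulr0.
have lN : \sum_i l i * f (x i) = - (nu / 2 * \sum_i `|l i| * enorm (x i - x ord0) ^+ 2).
  rewrite mulr_sumr -sumrN; apply: eq_bigr => i _.
  have [->|i0] := eqVneq i ord0; last by rewrite ler0_norm ?hi // /f; lra.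
  by rewrite f0 mulrCA [nu / 2 * _]f0 !mulr0 oppr0.
rewrite lN -opprD normrN addrC -mulrDr ger0_norm // mulr_ge0 ?divr_ge0 //.
by rewrite addr_ge0 ?sqr_ge0 // sumr_ge0 // => i _; rewrite mulr_ge0 ?sqr_ge0.
Qed.

End SharpBound.

Theorem theorem4p4 (R : realType) (n : nat) (nu : R) (hnu : 0 < nu)
    (x : 'I_n.+1 -> 'rV[R]_n) (hx : affinely_independent x)
    (x0 : 'rV[R]_n)
    (h1 : 0 < lagrange_poly x ord0 x0)
    (hi : forall i : 'I_n.+1, i != ord0 -> lagrange_poly x i x0 <= 0) :
  w_center x x0 = x ord0 /\ is_sharp_error_bound nu x x0 (zbar nu x x0).
Proof.
split; first exact: w_center_eq.
split.
  exists (fun u => nu / 2 * enorm (u - x ord0) ^+ 2).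
    exact/scaled_sqdist_C11/ltW.
  exact/interpolation_error_sqdist/ltW.
by move=> _ [f fC <-]; exact: interpolation_error_le.
Qed.
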